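(* Let $C,C',D$ be at most countable sets, let $u\in\Delta\bigl(K\times(C\times C')\times D\bigr)$ and let $v=\mathrm{marg}_{K\times C\times D}u$. Suppose that the information in $u$ (and therefore in $v$) is conditionally independent. Then $$d(u,v)=d_1(u,v).$$
   Context: $K$ is a finite set with $|K|\ge2$. An information structure is a probability on $K\times S_1\times S_2$ with $S_1,S_2$ at most countable, where $k\in K$ is the state, $S_i$ is the set of signals of player $i$. In $u$, player 1's signal is the pair $(c,c')\in C\times C'$ and player 2's signal is $d\in D$; in $v$, player 1's signal is $c$ only. An information structure has conditionally independent information if the signals of player 1 and player 2 are conditionally independent given $k$ (for $u$: $(c,c')$ and $d$ are conditionally independent given $k$). A payoff function is a map $g:K\times I\times J\to[-1,1]$ with $I,J$ nonempty finite sets; $\mathcal{G}$ is the set of all payoff functions. In the zero-sum Bayesian game $\Gamma(u,g)$, $(k,s_1,s_2)$ is drawn from $u$, player $i$ learns $s_i$, they simultaneously choose $i\in I$ and $j\in J$, and player 1 (the maximizer) receives $g(k,i,j)$ from player 2; $\mathrm{val}(u,g)$ is its value in mixed strategies. The value-based distance is $d(u,v)=\sup_{g\in\mathcal{G}}|\mathrm{val}(u,g)-\mathrm{val}(v,g)|$. $\mathcal{G}_1\subset\mathcal{G}$ is the set of single-agent (player 1) problems, i.e. payoff functions $g$ with $g(k,i,j)=g(k,i,j')$ for all $k\in K$, $i\in I$, $j,j'\in J$, and $d_1(u,v)=\sup_{g\in\mathcal{G}_1}|\mathrm{val}(u,g)-\mathrm{val}(v,g)|$. *)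

(* Defs.v *)
From HB Require Import structures.
From mathcomp Require Import all_boot all_order all_algebra.
From mathcomp Require Import boolp classical_sets reals ereal numfun esum.

Set Implicit Arguments.
Unset Strict Implicit.
Unset Printing Implicit Defensive.

Import Order.TTheory GRing.Theory Num.Theory.
Local Open Scope classical_set_scope.
Local Open Scope ring_scope.

Section Sums.
Variables (R : realType) (T : choiceType).

(* [esum] is only meaningful for nonnegative families, hence the split into
   positive and negative parts.  The result is the usual sum of [f] when [f] is
   absolutely summable; [fine] gives a junk value otherwise. *)
Definition csum (f : T -> R) : R :=
  fine (\esum_(t in [set: T]) (f^\+ t)%:E)
  - fine (\esum_(t in [set: T]) (f^\- t)%:E).

Lemma csum_ge0E (f : T -> R) : (forall t, 0 <= f t) ->
  csum f = fine (\esum_(t in [set: T]) (f t)%:E).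
Proof.
move=> f0; rewrite /csum (_ : esum _ (fun t => (f^\- t)%:E) = 0%E).
  rewrite subr0; congr fine; apply: eq_esum => t _.
  by rewrite /funrpos/= (max_idPl _).
by apply: esum1 => t _; rewrite /funrneg/= (max_idPr _)// oppr_le0.
Qed.

End Sums.

Section InfoStructures.
Variables (R : realType) (K : finType).

Record info_struct (S1 S2 : countType) := InfoStruct {
  mass :> K * S1 * S2 -> R ;
  mass_ge0 : forall x, 0 <= mass x ;
  mass_sum1 : (\esum_(x in [set: K * S1 * S2]) (mass x)%:E = 1)%E }.

Section CondIndep.
Variables (S1 S2 : countType) (u : info_struct S1 S2).

Definition prob_state (k : K) : R :=
  csum (fun s : S1 * S2 => u (k, s.1, s.2)).
Definition cond_prob (k : K) (s1 : S1) (s2 : S2) : R :=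
  u (k, s1, s2) / prob_state k.
Definition cond_prob1 (k : K) (s1 : S1) : R :=
  csum (fun s2 => u (k, s1, s2)) / prob_state k.
Definition cond_prob2 (k : K) (s2 : S2) : R :=
  csum (fun s1 => u (k, s1, s2)) / prob_state k.

Definition conditionally_independent : Prop :=
  forall k, 0 < prob_state k -> forall s1 s2,
    cond_prob k s1 s2 = cond_prob1 k s1 * cond_prob2 k s2.

End CondIndep.

Section Marginal.
Variables (C C' D : countType) (u : info_struct (C * C')%type D).

Definition marg_mass (x : K * C * D) : R :=
  csum (fun c' : C' => u (x.1.1, (x.1.2, c'), x.2)).

Lemma marg_massE x :
  (marg_mass x)%:E = \esum_(c' in [set: C']) (u (x.1.1, (x.1.2, c'), x.2))%:E.
Proof.
rewrite /marg_mass csum_ge0E; last by move=> ?; exact: mass_ge0.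
rewrite fineK// ge0_fin_numE; last first.
  by apply: esum_ge0 => c' _; rewrite lee_fin; exact: mass_ge0.
rewrite (@le_lt_trans _ _ 1%E) ?ltry// -(mass_sum1 u).
pose e (c' : C') := (x.1.1, (x.1.2, c'), x.2).
rewrite -(esum_image [set: C'] e (fun y => (u y)%:E)); last first.
  by move=> a b _ _ [].
rewrite [leLHS]esum_mkcond; apply: le_esum => y _.
by case: ifP => // _; rewrite lee_fin mass_ge0.
Qed.

Lemma marg_mass_ge0 x : 0 <= marg_mass x.
Proof.
rewrite -lee_fin marg_massE.
by apply: esum_ge0 => c' _; rewrite lee_fin mass_ge0.
Qed.

Lemma marg_mass_sum1 : (\esum_(x in [set: K * C * D]) (marg_mass x)%:E = 1)%E.
Proof.
under eq_esum do rewrite marg_massE.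
rewrite (@esum_esum _ _ _ [set: K * C * D] (fun=> [set: C'])
  (fun x c' => (u (x.1.1, (x.1.2, c'), x.2))%:E)); last first.
  by move=> *; rewrite lee_fin mass_ge0.
rewrite -(mass_sum1 u).
rewrite (reindex_esum ([set: K * C * D] `*`` fun=> [set: C']) setT
  (fun z : (K * C * D) * C' => (z.1.1.1, (z.1.1.2, z.2), z.1.2)))//.
split => //=.
- by move=> [[[a b] c] d] [[[a' b'] c'] d'] _ _ /= [-> -> -> ->].
- by move=> [[a [b d]] c] _; exists ((a, b, c), d).
Qed.

Definition marg_info : info_struct C D :=
  InfoStruct marg_mass_ge0 marg_mass_sum1.

End Marginal.

Record payoff := Payoff {
  act1 : finType ;
  act2 : finType ;
  act1_neq0 : (0 < #|act1|)%N ;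
  act2_neq0 : (0 < #|act2|)%N ;
  payoff_fun :> K -> act1 -> act2 -> R ;
  payoff_bounded : forall k i j, -1 <= payoff_fun k i j <= 1 }.

Definition single_agent (g : payoff) : Prop :=
  forall k i j j', g k i j = g k i j'.

Definition strategy (S : countType) (A : finType) : set (S -> A -> R) :=
  [set s | forall x, (forall a, 0 <= s x a) /\ \sum_a s x a = 1].

Section Game.
Variables (S1 S2 : countType) (u : info_struct S1 S2) (g : payoff).

Definition expected_payoff (s : S1 -> act1 g -> R) (t : S2 -> act2 g -> R) : R :=
  csum (fun x : K * S1 * S2 =>
    u x * \sum_i \sum_j s x.1.2 i * t x.2 j * g x.1.1 i j).

Definition maxmin : R :=
  sup [set inf [set expected_payoff s t | t in @strategy S2 (act2 g)]
      | s in @strategy S1 (act1 g)].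

Definition minmax : R :=
  inf [set sup [set expected_payoff s t | s in @strategy S1 (act1 g)]
      | t in @strategy S2 (act2 g)].

Definition is_value (w : R) : Prop := w = maxmin /\ w = minmax.

(* The default 0 would only be returned if the game had no value, which the
   minimax theorem excludes. *)
Definition game_value : R := xget 0 [set w | is_value w].

End Game.

Section Distances.
Variables (S1 S2 T1 T2 : countType).
Variables (u : info_struct S1 S2) (v : info_struct T1 T2).

(* The sets below are nonempty and bounded above by 2, so the supremum can be
   taken in [R]. *)
Definition value_dist : R :=
  sup [set r | exists g : payoff, r = `|game_value u g - game_value v g|].

Definition value_dist1 : R :=
  sup [set r | exists2 g : payoff, single_agent g &
                 r = `|game_value u g - game_value v g|].

End Distances.

End InfoStructures.

(* Main.v *)
From mathcomp Require Import all_boot all_order all_algebra.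
From mathcomp Require Import boolp classical_sets functions fsbigop.
From mathcomp Require Import reals ereal numfun esum.
From mathcomp Require Import ring lra.
Require Import Defs.

Set Implicit Arguments.
Unset Strict Implicit.
Unset Printing Implicit Defensive.

Import Order.TTheory GRing.Theory Num.Theory.
Local Open Scope classical_set_scope.
Local Open Scope ring_scope.

(** Conditional independence splits the mass as
    [u (k, s1, s2) = al k s1 * be k s2] with every [be k] a probability, and
    forgetting [c'] changes [al] but neither [be] nor the total masses [p k].
    Hence, whatever player 2 does, player 1 only faces the mixed action that
    player 2 induces in each state.

    Fix a payoff [g] and let [t] be an [e]-optimal strategy of player 2 in the
    game played on the marginal [v].  Averaging [g] against the mixed actions
    induced by [t] gives a problem [h] for player 1 alone, whose value in an
    information structure is the best payoff of player 1 against [t] there.  So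
    the value of [h] in [v] is at most [val v g + e], because [t] is
    [e]-optimal, while in [u] it is at least [val u g], because [t] has no
    reason to be optimal there.  As player 1 is better informed in [u] than in
    [v], [val u g - val v g] is nonnegative, and it is at most
    [val u h - val v h + e].  The lemmas that carry this are
    [product_form_of_cond_indep], [marg_product_form],
    [payoff_against_marg_le] and [reply_problem_value].

    Since [game_value] is meaningful only when maxmin and minmax agree, the
    minimax theorem is needed, with countably many signals and thus infinitely
    many pure strategies.  In product form the expected payoff is a scalar
    product of two vectors indexed by the finite type [K * act1 g]
    ([expected_payoffE]), which range over bounded convex sets as the
    strategies vary.  These sets are not known to be closed, so optimal
    strategies are avoided: [minimax_approx] finds almost optimal ones by
    minimizing a regularized best-response payoff almost exactly. *)

(** * Sums of nonnegative families *)

Section SumsTo.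
Variable R : realType.
Implicit Types T U : choiceType.

(** Nonnegativity is part of the relation because [esum] is the sum of the
    family only in that case; the real value records finiteness. *)
Definition sums_to T (f : T -> R) (r : R) : Prop :=
  (forall t, 0 <= f t) /\ (\esum_(t in [set: T]) (f t)%:E = r%:E)%E.

Lemma csum_sums_to T (f : T -> R) r : sums_to f r -> csum f = r.
Proof. by move=> [f0 fr]; rewrite csum_ge0E// fr. Qed.

Lemma sums_to_ge0 T (f : T -> R) r : sums_to f r -> 0 <= r.
Proof.
move=> [f0 fr]; rewrite -lee_fin -fr.
by apply: esum_ge0 => t _; rewrite lee_fin.
Qed.

Lemma sums_to_le T (f g : T -> R) r : (forall t, 0 <= f t <= g t) ->
  sums_to g r -> sums_to f (csum f) /\ csum f <= r.
Proof.
move=> fg [g0 gr].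
have f0 t : 0 <= f t by case/andP: (fg t).
have le : (\esum_(t in [set: T]) (f t)%:E <= r%:E)%E.
  by rewrite -gr; apply: le_esum => t _; rewrite lee_fin; case/andP: (fg t).
have sf : sums_to f (csum f).
  split=> //; rewrite csum_ge0E// fineK// ge0_fin_numE.
    by rewrite (le_lt_trans le)// ltry.
  by apply: esum_ge0 => t _; rewrite lee_fin.
by split=> //; rewrite -lee_fin -sf.2.
Qed.

Lemma sums_to_term_le T (f : T -> R) r t : sums_to f r -> f t <= r.
Proof.
move=> [f0 fr]; rewrite -lee_fin -fr (esumID [set t])//; last first.
  by move=> x _; rewrite lee_fin.
rewrite setTI esum_set1 ?lee_fin// leeDl//.
by apply: esum_ge0 => x _; rewrite lee_fin.
Qed.

Lemma sums_to0 T : sums_to (fun _ : T => 0) 0.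
Proof. by split=> //; apply: esum1. Qed.

Lemma sums_toD T (f g : T -> R) a b : sums_to f a -> sums_to g b ->
  sums_to (fun t => f t + g t) (a + b).
Proof.
move=> [f0 fa] [g0 gb]; split=> [t|]; first exact: addr_ge0.
rewrite EFinD -fa -gb -esumD => [|t _|t _]; rewrite ?lee_fin//.
Qed.

Lemma sums_to_sum T (I : finType) (f : I -> T -> R) r :
  (forall i, sums_to (f i) (r i)) ->
  sums_to (fun t => \sum_i f i t) (\sum_i r i).
Proof.
move=> fr; split=> [t|]; first by apply: sumr_ge0 => i _; exact: (fr i).1.
under eq_esum do rewrite -sumEFin.
rewrite esum_sum; last by move=> t i _ _; rewrite lee_fin (fr i).1.
by rewrite -sumEFin; apply: eq_bigr => i _; rewrite (fr i).2.
Qed.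

(** Scaling a supremum gives one inequality for every factor; the converse is
    the same inequality for the inverse factor. *)
Lemma sums_toZ T (f : T -> R) c a : 0 <= c -> sums_to f a ->
  sums_to (fun t => c * f t) (c * a).
Proof.
have ub (d : R) (h : T -> R) : 0 <= d -> (forall t, 0 <= h t) ->
    (\esum_(t in [set: T]) (d * h t)%:E <=
     d%:E * \esum_(t in [set: T]) (h t)%:E)%E.
  move=> d0 h0; apply: ge_ereal_sup => _ [X XT <-].
  under eq_fsbigr do rewrite EFinM.
  rewrite -ge0_mule_fsumr; last by move=> t; rewrite lee_fin.
  by apply: lee_wpmul2l => //; apply: ereal_sup_ubound; exists X.
rewrite le_eqVlt => /predU1P[<- _|c0 [f0 fa]].
  by rewrite mul0r (_ : (fun _ => _) = fun=> 0);
    [exact: sums_to0|apply/funext => t; rewrite mul0r].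
split=> [t|]; first by rewrite mulr_ge0// ltW.
apply/eqP; rewrite eq_le EFinM -fa ub ?(ltW c0)//=.
have := ub c^-1 (fun t => c * f t); rewrite invr_ge0 ltW// => /(_ isT).
under eq_esum do rewrite mulKf ?gt_eqF//.
move=> /(_ (fun t => mulr_ge0 (ltW c0) (f0 t))) le_fa.
have c0' : (0 <= c%:E)%E by rewrite lee_fin ltW.
by have := lee_wpmul2l c0' le_fa; rewrite muleA -EFinM mulfV ?gt_eqF// mul1e.
Qed.

Lemma sums_to_uncurry T U (f : T -> U -> R) g r :
  (forall t, sums_to (f t) (g t)) -> sums_to g r ->
  sums_to (fun x : T * U => f x.1 x.2) r.
Proof.
move=> fg [g0 gr]; split=> [x|]; first exact: (fg x.1).1.
rewrite -gr; under [RHS]eq_esum do rewrite -(fg _).2.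
rewrite (@esum_esum _ _ _ setT (fun=> setT) (fun t u => (f t u)%:E)).
  by congr esum; apply/seteqP; split.
by move=> *; rewrite lee_fin (fg _).1.
Qed.

Lemma sums_to_inj T U (e : T -> U) (f : U -> R) r : injective e ->
  sums_to f r -> sums_to (f \o e) (csum (f \o e)).
Proof.
move=> inje [f0 fr].
have fe0 t : 0 <= (f \o e) t by exact: f0.
split=> //; rewrite csum_ge0E// fineK// ge0_fin_numE; last first.
  by apply: esum_ge0 => t _; rewrite lee_fin.
rewrite (@le_lt_trans _ _ r%:E) ?ltry// -fr.
rewrite -(esum_image [set: T] e (fun y => (f y)%:E)); last first.
  by move=> ? ? _ _ /inje.
rewrite [leLHS]esum_mkcond; apply: le_esum => y _.
by case: ifP => // _; rewrite lee_fin.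
Qed.

Lemma sums_to_curry T U (f : T * U -> R) r : sums_to f r ->
  (forall t, sums_to (fun u => f (t, u)) (csum (fun u => f (t, u)))) /\
  sums_to (fun t => csum (fun u => f (t, u))) r.
Proof.
move=> fr.
have ft t : sums_to (fun u => f (t, u)) (csum (fun u => f (t, u))).
  by apply: (sums_to_inj (e := pair t)) fr => a b [].
split=> //; split=> [t|]; first exact: sums_to_ge0 (ft t).
rewrite -fr.2; under eq_esum do rewrite -(ft _).2.
rewrite (@esum_esum _ _ _ setT (fun=> setT) (fun t u => (f (t, u))%:E)).
  rewrite (_ : _ `*`` _ = setT); last by apply/seteqP; split.
  by apply: eq_esum => -[].
by move=> *; rewrite lee_fin fr.1.
Qed.

Lemma sums_to_swap T U (f : T * U -> R) r : sums_to f r ->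
  sums_to (fun x : U * T => f (x.2, x.1)) r.
Proof.
move=> [f0 fr]; split=> // ; rewrite -fr.
rewrite (reindex_esum [set: U * T] setT (fun x => (x.2, x.1)))//.
split=> // [[a b] [c d] _ _ [-> ->]//|[a b] _]; by exists (b, a).
Qed.

Lemma sums_toM T U (f : T -> R) (g : U -> R) a b :
  sums_to f a -> sums_to g b ->
  sums_to (fun x : T * U => f x.1 * g x.2) (a * b).
Proof.
move=> fa gb; apply: (@sums_to_uncurry _ _ (fun t u => f t * g u)
  (fun t => f t * b)) => [t|].
  exact/sums_toZ/gb/fa.1.
under eq_fun do rewrite mulrC.
by rewrite mulrC; apply: sums_toZ => //; exact: sums_to_ge0 gb.
Qed.

Lemma sums_to_delta T (t0 : T) : sums_to (fun t => (t == t0)%:R) 1.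
Proof.
split=> // ; rewrite -[1%E](@esum_set1 R T t0 (fun=> 1%E))//.
rewrite [RHS]esum_mkcond; apply: eq_esum => t _.
by rewrite in_set1; case: eqP.
Qed.

(** The positive and negative parts of [f - g] are dominated by [f] and [g], so
    all the sums involved are finite and [esumB] can be read in [R]. *)
Lemma csumB T (f g : T -> R) a b : sums_to f a -> sums_to g b ->
  csum (fun t => f t - g t) = a - b.
Proof.
move=> [f0 fa] [g0 gb].
have sf (h : T -> R) c : (forall t, 0 <= h t) ->
    (\esum_(t in [set: T]) (h t)%:E = c%:E)%E ->
    summable [set: T] (fun t => (h t)%:E).
  move=> h0 hc; rewrite /summable.
  by under eq_esum do rewrite gee0_abs ?lee_fin//; rewrite hc ltry.
have := @esumB R T setT (fun t => (f t)%:E) (fun t => (g t)%:E)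
  (sf _ _ f0 fa) (sf _ _ g0 gb).
rewrite fa gb => /(_ (fun t _ => f0 t) (fun t _ => g0 t)).
have le1 : forall t, 0 <= Num.max (f t - g t) 0 <= f t.
  by move=> t; rewrite le_max lexx orbT ge_max f0 lerBlDr lerDl g0.
have le2 : forall t, 0 <= Num.max (- (f t - g t)) 0 <= g t.
  by move=> t; rewrite le_max lexx orbT ge_max g0 opprB lerBlDr lerDl f0.
have [[_ s1] _] := sums_to_le le1 (conj f0 fa).
have [[_ s2] _] := sums_to_le le2 (conj g0 gb).
have -> : (\esum_(t in [set: T])
    ((fun t => (f t)%:E) \- (fun t => (g t)%:E))^\+ t =
    \esum_(t in [set: T]) (Num.max (f t - g t) 0)%:E)%E.
  by apply: eq_esum => t _; rewrite funeposE EFin_max.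
have -> : (\esum_(t in [set: T])
    ((fun t => (f t)%:E) \- (fun t => (g t)%:E))^\- t =
    \esum_(t in [set: T]) (Num.max (- (f t - g t)) 0)%:E)%E.
  by apply: eq_esum => t _; rewrite funenegE EFin_max.
rewrite s1 s2 -!EFinB => -[<-]; rewrite /csum /funrpos /funrneg /=.
by rewrite s1 s2.
Qed.

(** Splitting the coefficients into positive and negative parts makes both
    halves nonnegative, so that only [csumB] deals with signs. *)
Lemma csum_linear T (I : finType) (c : I -> R) (f : I -> T -> R) r :
  (forall i, sums_to (f i) (r i)) ->
  csum (fun t => \sum_i c i * f i t) = \sum_i c i * r i.
Proof.
move=> fr.
have h (d : I -> R) : (forall i, 0 <= d i) ->
    sums_to (fun t => \sum_i d i * f i t) (\sum_i d i * r i).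
  by move=> d0; apply: sums_to_sum => i; exact: sums_toZ.
have cE i : c i = Num.max (c i) 0 - Num.max (- c i) 0.
  case: (leP 0 (c i)) => ci; first by rewrite max_r ?oppr_le0// subr0.
  by rewrite max_l ?oppr_ge0 ?ltW// sub0r opprK.
have p0 i : 0 <= Num.max (c i) 0 by rewrite le_max lexx orbT.
have n0 i : 0 <= Num.max (- c i) 0 by rewrite le_max lexx orbT.
transitivity (\sum_i Num.max (c i) 0 * r i - \sum_i Num.max (- c i) 0 * r i).
  rewrite -(csumB (h _ p0) (h _ n0)); congr csum; apply/funext => t.
  by rewrite -sumrB; apply: eq_bigr => i _; rewrite -mulrBl -cE.
by rewrite -sumrB; apply: eq_bigr => i _; rewrite -mulrBl -cE.
Qed.

End SumsTo.

(** * A minimax theorem on bounded convex sets *)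

Section Minimax.
Variable R : realType.

Definition dot (X : finType) (a w : X -> R) : R := \sum_x a x * w x.

(** A segment is written as a base point plus a multiple of a difference, the
    form in which small moves are made in [minimax_approx]. *)
Definition convex_set (X : finType) (A : set (X -> R)) : Prop :=
  forall l a b, 0 <= l <= 1 -> A a -> A b ->
    A (fun x => a x + l * (b x - a x)).

Definition coord_bounded (X : finType) (A : set (X -> R)) (M : R) : Prop :=
  forall a, A a -> forall x, `|a x| <= M.

Lemma dot_bounded (X : finType) (A W : set (X -> R)) MA MW a w :
  coord_bounded A MA -> coord_bounded W MW -> A a -> W w ->
  `|dot a w| <= \sum_(x : X) MA * MW.
Proof.
move=> bA bW Aa Ww; apply: le_trans (ler_norm_sum _ _ _) _.
by apply: ler_sum => x _; rewrite normrM ler_pM// ?bA ?bW.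
Qed.

Lemma sqr_dot_bounded (X : finType) (a : X -> R) M :
  (forall x, `|a x| <= M) -> dot a a <= \sum_(x : X) M ^+ 2.
Proof.
move=> aM; apply: ler_sum => x _; rewrite -expr2 -real_normK ?num_real//.
by rewrite ler_pXn2r ?nnegrE// (le_trans _ (aM x)).
Qed.

(** The payoff [dot a w - mu / 2 * dot a a] is strongly concave in [a].  If
    its value at the midpoint of [a] and [a'] is at most [H], then an [a]
    within [eta] of [H] beats [a'] by a multiple of the squared distance, up to
    [eta].  This quadratic gain absorbs the first-order effect of moving [w]
    in the direction [h], so the new maximum is governed by the old
    near-maximizer [a]. *)
Lemma regularized_increment (X : finType)
    (mu t H eta : R) (a a' w h : X -> R) : 0 < mu ->
  dot a w - mu / 2 * dot a a >= H - eta ->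
  dot (fun x => a x + 2^-1 * (a' x - a x)) w
    - mu / 2 * dot (fun x => a x + 2^-1 * (a' x - a x))
                   (fun x => a x + 2^-1 * (a' x - a x)) <= H ->
  dot a' (fun x => w x + t * h x) - mu / 2 * dot a' a' <=
    H + eta + t * dot a h + t ^+ 2 / mu * dot h h.
Proof.
move=> mu0 Ha Hm.
suff : dot a' (fun x => w x + t * h x) - mu / 2 * dot a' a' <=
  2 * (dot (fun x => a x + 2^-1 * (a' x - a x)) w
    - mu / 2 * dot (fun x => a x + 2^-1 * (a' x - a x))
                   (fun x => a x + 2^-1 * (a' x - a x)))
  - (dot a w - mu / 2 * dot a a) + t * dot a h + t ^+ 2 / mu * dot h h.
  by move: Ha Hm; lra.
(* Coordinatewise, the slack in the inequality is a perfect square. *)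
rewrite /dot !mulr_sumr -!sumrB !mulr_sumr -!sumrB -!big_split/=.
apply: ler_sum => x _; rewrite -subr_ge0.
rewrite [leRHS](_ : _ =
  mu * (2^-1 * (a' x - a x) - t / mu * h x) ^+ 2); last first.
  by field; rewrite gt_eqF.
by rewrite mulr_ge0 ?sqr_ge0// ltW.
Qed.

(** Let [H w] be the maximal regularized payoff against [w], let [w] almost
    minimize [H] and let [a] be almost optimal against [w].  By hypothesis some
    [w'] brings the payoff of [a] down to [alpha].  Moving [w] a step [t]
    towards [w'] cannot decrease [H] by more than [eta], whereas by
    [regularized_increment] it raises [H] by at most
    [t * (dot a w' - dot a w)] plus terms of order [eta] and [t ^+ 2 / mu].
    Hence [dot a w] is hardly above [alpha], and so is [H w], which bounds
    [dot a' w] for all [a'] up to [mu * Q]. *)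
Lemma minimax_approx (X : finType) (A W : set (X -> R)) (MA MW alpha e : R) :
  A !=set0 -> W !=set0 -> convex_set A -> convex_set W ->
  coord_bounded A MA -> coord_bounded W MW ->
  (forall a, A a -> exists2 w, W w & dot a w <= alpha) ->
  0 < e ->
  exists2 w, W w & forall a, A a -> dot a w <= alpha + e.
Proof.
move=> [a0 Aa0] [w0 Ww0] cA cW bA bW alphaP.
wlog e1 : e / e <= 1 => [hw e0|e0].
  have [||w Ww wP] := hw (Num.min e 1); rewrite ?ge_min ?lexx ?orbT//.
    by rewrite lt_min e0 ltr01.
  by exists w => // a Aa; rewrite (le_trans (wP _ Aa))// lerD2l ge_min lexx.
pose Q := 1 + (\sum_(x : X) MA ^+ 2 + \sum_(x : X) (MW + MW) ^+ 2).
pose N := \sum_(x : X) MA * MW.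
have sq0 (m : R) : 0 <= \sum_(x : X) m ^+ 2.
  by apply: sumr_ge0 => x _; exact: sqr_ge0.
have Q1 : 1 <= Q by rewrite lerDl addr_ge0.
have QA a : A a -> 0 <= dot a a <= Q.
  move=> Aa; rewrite sumr_ge0 /=; last by move=> x _; rewrite -expr2 sqr_ge0.
  by have := sqr_dot_bounded (bA _ Aa); have := sq0 (MW + MW); rewrite /Q; lra.
have QW w w' : W w -> W w' ->
    dot (fun x => w' x - w x) (fun x => w' x - w x) <= Q.
  move=> Ww Ww'; apply: (@le_trans _ _ (\sum_(x : X) (MW + MW) ^+ 2)).
    apply: sqr_dot_bounded => x; apply: le_trans (ler_normB _ _) _.
    by apply: lerD; apply: bW.
  by have := sq0 MA; rewrite /Q; lra.
(* The regularization [mu] costs at most [e / 4], the step [t] costs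
   [t / mu * Q = e / 4], and [eta] is small compared with [t] since it is
   divided by [t] in the end. *)
pose mu := e / (2 * Q).
have Q0 : 0 < Q by lra.
have mu0 : 0 < mu by rewrite divr_gt0// mulr_gt0.
have muQ : mu * Q = e / 2 by rewrite /mu; field; rewrite gt_eqF.
pose t := e * mu / (4 * Q).
have t0 : 0 < t by rewrite !mulr_gt0// invr_gt0 mulr_gt0.
have tQ : t / mu * Q = e / 4 by rewrite /t; field; rewrite !gt_eqF.
have mule1 : mu <= 1 by nra.
have t1 : t <= 1.
  rewrite /t ler_pdivrMr ?mulr_gt0// mul1r.
  by apply: (@le_trans _ _ 1); [rewrite mulr_ile1// ltW | lra].
pose eta := e * t / 16.
have eta0 : 0 < eta by rewrite divr_gt0// mulr_gt0.
have etale : eta <= e / 16.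
  by rewrite /eta ler_pM2r ?invr_gt0// ger_pMr.
pose F (w a : X -> R) := dot a w - mu / 2 * dot a a.
pose H (w : X -> R) := sup [set F w a | a in A].
have dotN (a w : X -> R) : A a -> W w -> - N <= dot a w <= N.
  by move=> Aa Ww; rewrite -ler_norml; apply: dot_bounded Aa Ww.
have FN w a : W w -> A a -> - N - mu / 2 * Q <= F w a <= N.
  move=> Ww Aa; have := dotN _ _ Aa Ww; have /andP[] := QA _ Aa.
  by rewrite /F; move: (dot a a) => s s0 sQ /andP[]; nra.
have Fub w : W w -> has_sup [set F w a | a in A].
  move=> Ww; split; first by exists (F w a0); exists a0.
  by exists N => _ [a Aa <-]; case/andP: (FN _ _ Ww Aa).
have FH w a : W w -> A a -> F w a <= H w.
  by move=> Ww Aa; apply: (sup_upper_bound (Fub _ Ww)); exists a.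
have Hinf : has_inf [set H w | w in W].
  split; first by exists (H w0); exists w0.
  exists (- N - mu / 2 * Q) => _ [w Ww <-].
  by rewrite (le_trans _ (FH _ _ Ww Aa0))//; case/andP: (FN _ _ Ww Aa0).
have [_ [w Ww <-] Hw] := inf_adherent eta0 Hinf.
have [_ [a Aa <-] Fa] := sup_adherent eta0 (Fub _ Ww).
rewrite -/(H w) in Fa.
have [w' Ww' aw'] := alphaP _ Aa.
pose h x := w' x - w x.
pose wt x := w x + t * h x.
have Wwt : W wt by apply: cW => //; rewrite ltW.
have Hwt : H wt <= H w + eta + t * dot a h + t ^+ 2 / mu * dot h h.
  apply: ge_sup; first by exists (F wt a0); exists a0.
  move=> _ [a' Aa' <-]; apply: regularized_increment => //; first exact: ltW.
  by apply: FH => //; apply: cA => //; lra.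
have Hwle : H w - eta <= H wt.
  by have := ge_inf Hinf.2 (ex_intro2 _ _ wt Wwt erefl); lra.
have dah : dot a h = dot a w' - dot a w.
  by rewrite /dot -sumrB; apply: eq_bigr => x _; rewrite mulrBr.
have tineq : dot a w <= alpha + 2 * eta / t + e / 4.
  have hh := QW _ _ Ww Ww'; rewrite -/h in hh.
  have tm0 : 0 < t / mu by rewrite divr_gt0.
  have th : t / mu * dot h h <= e / 4 by rewrite -tQ ler_pM2l.
  have : 0 <= t * (dot a h + t / mu * dot h h) + 2 * eta.
    by move: Hwt Hwle; rewrite expr2; lra.
  have -> : t * (dot a h + t / mu * dot h h) + 2 * eta =
      t * (dot a h + t / mu * dot h h + 2 * eta / t) by field; rewrite !gt_eqF.
  by rewrite pmulr_rge0// dah; lra.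
have etat : 2 * eta / t = e / 8 by rewrite /eta; field; rewrite gt_eqF.
have /andP[aa0 _] := QA _ Aa.
exists w => // a' Aa'; have := FH _ _ Ww Aa'; rewrite /F.
have /andP[_ a'Q] := QA _ Aa'.
have : mu / 2 * dot a' a' <= e / 4.
  apply: (@le_trans _ _ (mu / 2 * Q)); first by rewrite ler_pM2l// divr_gt0.
  by lra.
have : 0 <= mu / 2 * dot a a by rewrite mulr_ge0// divr_ge0// ltW.
move: Fa; rewrite /F.
by lra.
Qed.

(** Approximate strategies are enough for the equality of the two values, as
    these are suprema and infima that need not be attained. *)
Lemma sup_inf_eq_inf_sup (S T : Type) (A : set S) (B : set T) (P : S -> T -> R)
    (M : R) : A !=set0 -> B !=set0 ->
  (forall s t, A s -> B t -> `|P s t| <= M) ->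
  (forall alpha e, (forall s, A s -> exists2 t, B t & P s t <= alpha) ->
     0 < e -> exists2 t, B t & forall s, A s -> P s t <= alpha + e) ->
  sup [set inf [set P s t | t in B] | s in A] =
  inf [set sup [set P s t | s in A] | t in B].
Proof.
move=> [s0 As0] [t0 Bt0] PM approx.
have PMl s t : A s -> B t -> - M <= P s t.
  by move=> As Bt; have := PM _ _ As Bt; rewrite ler_norml => /andP[].
have PMr s t : A s -> B t -> P s t <= M.
  by move=> As Bt; have := PM _ _ As Bt; rewrite ler_norml => /andP[].
have row s : A s -> has_inf [set P s t | t in B].
  move=> As; split; first by exists (P s t0); exists t0.
  by exists (- M) => _ [t Bt <-]; exact: PMl.
have col t : B t -> has_sup [set P s t | s in A].
  move=> Bt; split; first by exists (P s0 t); exists s0.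
  by exists M => _ [s As <-]; exact: PMr.
have infP s t : A s -> B t -> inf [set P s t | t in B] <= P s t.
  by move=> As Bt; apply: ge_inf; [exact: (row _ As).2|exists t].
have supP s t : A s -> B t -> P s t <= sup [set P s t | s in A].
  by move=> As Bt; apply: ub_le_sup; [exact: (col _ Bt).2|exists s].
apply/eqP; rewrite eq_le; apply/andP; split.
  apply: ge_sup; first by eexists; exists s0.
  move=> _ [s As <-]; apply: lb_le_inf; first by eexists; exists t0.
  by move=> _ [t Bt <-]; rewrite (le_trans (infP _ _ As Bt))// supP.
set m := sup _.
have infm s : A s -> inf [set P s t | t in B] <= m.
  move=> As; apply: ub_le_sup; last by exists s.
  by exists M => _ [s' As' <-]; rewrite (le_trans (infP _ _ As' Bt0))// PMr.
apply/ler_addgt0Pr => e e0.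
have e20 : 0 < e / 2 by rewrite divr_gt0.
have [s As|t Bt tP] := approx (m + e / 2) (e / 2) _ e20.
  have [_ [t Bt <-] Pt] := inf_adherent e20 (row _ As).
  by exists t => //; rewrite (le_trans (ltW Pt))// lerD2r infm.
apply: (@le_trans _ _ (sup [set P s t | s in A])).
  apply: ge_inf; last by exists t.
  exists (- M) => _ [t' Bt' <-].
  by rewrite (le_trans _ (supP _ _ As0 Bt'))// PMl.
apply: ge_sup; first by eexists; exists s0.
by move=> _ [s As <-]; have := tP _ As; lra.
Qed.

End Minimax.

(** * Strategies and the vectors they induce *)

Section Induced.
Variables (R : realType) (K : finType).

Section OnePlayer.
Variables (S : countType) (I : finType) (al : K -> S -> R) (p : K -> R).
Hypothesis al_sums : forall k, sums_to (al k) (p k).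
Implicit Types s : S -> I -> R.

(** When [al k] is a probability this is the conditional law of the action in
    state [k]; in general it is weighted by the total mass [p k]. *)
Definition induced s (x : K * I) : R :=
  csum (fun z => al x.1 z * s z x.2).

Lemma strategy_le1 s z i : strategy s -> 0 <= s z i <= 1.
Proof.
move=> /(_ z)[s0 <-]; rewrite s0/= (bigD1 i)//= lerDl.
by apply: sumr_ge0 => j _; exact: s0.
Qed.

Lemma induced_sums_to s x : strategy s ->
  sums_to (fun z => al x.1 z * s z x.2) (induced s x).
Proof.
move=> ss; apply: (sums_to_le _ (al_sums x.1)).1 => z.
have /andP[s0 s1] := strategy_le1 z x.2 ss.
have a0 := (al_sums x.1).1 z.
by rewrite mulr_ge0//= ler_piMr.
Qed.

Lemma induced_ge0 s x : strategy s -> 0 <= induced s x.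
Proof. by move=> ss; exact: sums_to_ge0 (induced_sums_to x ss). Qed.

Lemma induced_sum s k : strategy s -> \sum_i induced s (k, i) = p k.
Proof.
move=> ss; rewrite -(csum_sums_to (al_sums k)).
have := sums_to_sum (fun i => induced_sums_to (k, i) ss).
move=> /csum_sums_to <-; congr csum; apply/funext => z /=.
by rewrite -mulr_sumr (ss z).2 mulr1.
Qed.

Lemma induced_le s x : strategy s -> induced s x <= p x.1.
Proof.
case: x => k i ss; rewrite -(induced_sum k ss) (bigD1 i)//= lerDl.
by apply: sumr_ge0 => j _; exact: induced_ge0.
Qed.

Lemma strategy_convex l s s' : 0 <= l <= 1 -> strategy s -> strategy s' ->
  strategy (fun z i => s z i + l * (s' z i - s z i)).
Proof.
move=> /andP[l0 l1] ss ss' z; split=> [i|].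
  have -> : s z i + l * (s' z i - s z i) = (1 - l) * s z i + l * s' z i by ring.
  by rewrite addr_ge0// mulr_ge0 ?subr_ge0 ?(ss z).1 ?(ss' z).1.
by rewrite big_split/= -mulr_sumr sumrB (ss z).2 (ss' z).2 subrr mulr0 addr0.
Qed.

Lemma induced_affine l s s' x : 0 <= l <= 1 -> strategy s -> strategy s' ->
  induced (fun z i => s z i + l * (s' z i - s z i)) x =
  induced s x + l * (induced s' x - induced s x).
Proof.
move=> /andP[l0 l1] ss ss'.
have l1' : 0 <= 1 - l by rewrite subr_ge0.
have := sums_toD (sums_toZ l1' (induced_sums_to x ss))
                 (sums_toZ l0 (induced_sums_to x ss')).
move=> /csum_sums_to; rewrite -/(induced s x) -/(induced s' x) => e.
transitivity ((1 - l) * induced s x + l * induced s' x); last by ring.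
by rewrite -e; congr csum; apply/funext => z; ring.
Qed.

End OnePlayer.

Lemma strategy_neq0 (S : countType) (I : finType) : (0 < #|I|)%N ->
  @strategy R S I !=set0.
Proof.
move=> /card_gt0P[i0 _]; exists (fun _ i => (i == i0)%:R) => z; split=> //.
by rewrite (bigD1 i0)//= eqxx big1 ?addr0// => i /negPf ->.
Qed.

(** * Games in product form *)

Section TwoPlayers.
Variables (S1 S2 : countType) (u : info_struct R K S1 S2).
Variables (p : K -> R) (al : K -> S1 -> R) (be : K -> S2 -> R).

(** The weight of each state is carried by player 1, so that [be] is a
    probability kernel, even in the states of probability zero. *)
Definition product_form : Prop :=
  [/\ forall k, sums_to (al k) (p k), forall k, sums_to (be k) 1
    & forall k s1 s2, u (k, s1, s2) = al k s1 * be k s2].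

(** The payoff of player 1 in each state when player 2 is replaced by the mixed
    actions that [t] induces. *)
Definition reply_payoff (g : payoff R K) (t : S2 -> act2 g -> R)
    (x : K * act1 g) : R :=
  \sum_j induced be t (x.1, j) * g x.1 x.2 j.

Hypothesis uP : product_form.

(** Player 1's and player 2's signals enter through separate factors, so the
    sum over all signals splits into a product for each state and each pair of
    actions. *)
Lemma expected_payoffE (g : payoff R K) (s : S1 -> act1 g -> R)
    (t : S2 -> act2 g -> R) : strategy s -> strategy t ->
  expected_payoff u s t = dot (induced al s) (reply_payoff t).
Proof.
case: uP => alP beP uE ss st.
pose c (z : K * act1 g * act2 g) := g z.1.1 z.1.2 z.2.
(* The indicator of the state makes each [f z] a product over the three
   coordinates. *)
pose f z (x : K * S1 * S2) :=
  (x.1.1 == z.1.1)%:R * (al z.1.1 x.1.2 * s x.1.2 z.1.2) *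
  (be z.1.1 x.2 * t x.2 z.2).
have fP (z : K * act1 g * act2 g) :
    sums_to (f z) (1 * induced al s z.1 * induced be t (z.1.1, z.2)).
  have h1 := induced_sums_to alP z.1 ss.
  have h2 := induced_sums_to beP (z.1.1, z.2) st.
  exact: sums_toM (sums_toM (sums_to_delta R z.1.1) h1) h2.
transitivity (csum (fun x => \sum_z c z * f z x)).
  congr csum; apply/funext => -[[k x1] x2] /=.
  rewrite -(pair_bigA _ (fun (y : K * act1 g) j =>
    c (y, j) * f (y, j) (k, x1, x2)))/=.
  rewrite -(pair_bigA _ (fun k' i =>
    \sum_j c (k', i, j) * f (k', i, j) (k, x1, x2)))/=.
  rewrite (bigD1 k)//= [X in _ + X]big1 ?addr0; last first.
    move=> k' kk'; apply: big1 => i _; apply: big1 => j _.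
    by rewrite /f/= eq_sym (negPf kk') !mul0r mulr0.
  rewrite mulr_sumr; apply: eq_bigr => i _; rewrite mulr_sumr.
  by apply: eq_bigr => j _; rewrite /f/= eqxx uE /c/=; ring.
rewrite (csum_linear c fP) /dot.
rewrite -(pair_bigA _ (fun (y : K * act1 g) j =>
  c (y, j) * (1 * induced al s y * induced be t (y.1, j))))/=.
apply: eq_bigr => y _; rewrite mulr_sumr; apply: eq_bigr => j _.
by rewrite /c/=; ring.
Qed.

Lemma reply_payoff_bounded (g : payoff R K) (t : S2 -> act2 g -> R) x :
  strategy t -> `|reply_payoff t x| <= 1.
Proof.
case: uP => _ beP _ st; rewrite -(induced_sum beP x.1 st).
apply: le_trans (ler_norm_sum _ _ _) _; apply: ler_sum => j _.
rewrite normrM (ger0_norm (induced_ge0 beP (x.1, j) st)).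
by rewrite ler_piMr ?(induced_ge0 beP)// ler_norml payoff_bounded.
Qed.

Lemma expected_payoff_bounded (g : payoff R K) (s : S1 -> act1 g -> R)
    (t : S2 -> act2 g -> R) : strategy s -> strategy t ->
  `|expected_payoff u s t| <= \sum_k p k.
Proof.
move=> ss st; rewrite expected_payoffE//; case: (uP) => alP _ _.
under eq_bigr do rewrite -(induced_sum alP _ ss).
rewrite (pair_bigA _ (fun k i => induced al s (k, i)))/=.
apply: le_trans (ler_norm_sum _ _ _) _; apply: ler_sum => -[k i] _ /=.
rewrite normrM (ger0_norm (induced_ge0 alP (k, i) ss)).
by rewrite ler_piMr ?(induced_ge0 alP)// reply_payoff_bounded.
Qed.

Lemma maxmin_minmax (g : payoff R K) : maxmin u g = minmax u g.
Proof.
case: (uP) => alP beP _.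
have [s0 ss0] := strategy_neq0 S1 (act1_neq0 g).
have [t0 st0] := strategy_neq0 S2 (act2_neq0 g).
apply: (@sup_inf_eq_inf_sup _ _ _ _ _ _ (\sum_k p k)).
- by exists s0.
- by exists t0.
- by move=> s t; exact: expected_payoff_bounded.
move=> alpha e hyp e0.
pose A := [set induced al s | s in @strategy R S1 (act1 g)].
pose W := [set reply_payoff t | t in @strategy R S2 (act2 g)].
have cA : convex_set A.
  move=> l _ _ l01 [s ss <-] [s' ss' <-].
  exists (fun z i => s z i + l * (s' z i - s z i)).
    exact: strategy_convex.
  by apply/funext => x; exact: (induced_affine alP).
have cW : convex_set W.
  move=> l _ _ l01 [t st <-] [t' st' <-].
  exists (fun z j => t z j + l * (t' z j - t z j)).
    exact: strategy_convex.
  apply/funext => x; rewrite /reply_payoff -sumrB mulr_sumr -big_split/=.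
  by apply: eq_bigr => j _; rewrite (induced_affine beP)//; ring.
have bA : coord_bounded A (\sum_k p k).
  move=> _ [s ss <-] x; rewrite ger0_norm ?(induced_ge0 alP)//.
  apply: (le_trans (induced_le alP x ss)); rewrite (bigD1 x.1)//= lerDl.
  by apply: sumr_ge0 => k _; exact: sums_to_ge0 (alP k).
have bW : coord_bounded W 1.
  by move=> _ [t st <-] x; exact: reply_payoff_bounded.
have A0 : A !=set0 by exists (induced al s0); exists s0.
have W0 : W !=set0 by exists (reply_payoff t0); exists t0.
have AW a : A a -> exists2 w, W w & dot a w <= alpha.
  move=> [s ss <-]; have [t st le] := hyp s ss.
  by exists (reply_payoff t); [exists t|rewrite -expected_payoffE].
have [_ [t st <-] wP] := minimax_approx A0 W0 cA cW bA bW AW e0.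
exists t => // s ss; rewrite expected_payoffE//; apply: wP; by exists s.
Qed.

Lemma game_valueE (g : payoff R K) : game_value u g = minmax u g.
Proof.
apply: xget_subset1; first by split=> //; rewrite maxmin_minmax.
by move=> w w' [-> _] [-> _].
Qed.

(** By the minimax theorem the value of the game is the infimum of this best
    payoff of player 1 over the strategies of player 2. *)
Definition payoff_against (g : payoff R K) (t : S2 -> act2 g -> R) : R :=
  sup [set expected_payoff u s t | s in @strategy R S1 (act1 g)].

Lemma payoff_against_has_sup (g : payoff R K) (t : S2 -> act2 g -> R) :
  strategy t ->
  has_sup [set expected_payoff u s t | s in @strategy R S1 (act1 g)].
Proof.
move=> st; have [s0 ss0] := strategy_neq0 S1 (act1_neq0 g).
split; first by eexists; exists s0.
exists (\sum_k p k) => _ [s ss <-].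
by have := expected_payoff_bounded ss st; rewrite ler_norml => /andP[].
Qed.

Lemma payoff_against_ge (g : payoff R K) (s : S1 -> act1 g -> R)
   (t : S2 -> act2 g -> R) :
  strategy s -> strategy t -> expected_payoff u s t <= payoff_against t.
Proof.
move=> ss st; apply: ub_le_sup; last by exists s.
exact: (payoff_against_has_sup st).2.
Qed.

Lemma payoff_against_bounded (g : payoff R K) (t : S2 -> act2 g -> R) :
  strategy t -> - (\sum_k p k) <= payoff_against t <= \sum_k p k.
Proof.
move=> st; have [s0 ss0] := strategy_neq0 S1 (act1_neq0 g).
have /andP[l _] : - (\sum_k p k) <= expected_payoff u s0 t <= \sum_k p k.
  by rewrite -ler_norml expected_payoff_bounded.
rewrite (le_trans l) ?payoff_against_ge//=.
apply: ge_sup; first exact: (payoff_against_has_sup st).1.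
move=> _ [s ss <-].
by have := expected_payoff_bounded ss st; rewrite ler_norml => /andP[].
Qed.

Lemma payoff_against_has_inf (g : payoff R K) :
  has_inf [set payoff_against t | t in @strategy R S2 (act2 g)].
Proof.
have [t0 st0] := strategy_neq0 S2 (act2_neq0 g).
split; first by exists (payoff_against t0); exists t0.
exists (- (\sum_k p k)) => _ [t st <-].
by case/andP: (payoff_against_bounded st).
Qed.

Lemma game_value_le (g : payoff R K) (t : S2 -> act2 g -> R) :
  strategy t -> game_value u g <= payoff_against t.
Proof.
by move=> st; rewrite game_valueE; apply: ge_inf;
  [exact: (payoff_against_has_inf g).2|exists t].
Qed.

Lemma game_value_ge (g : payoff R K) x :
  (forall t : S2 -> act2 g -> R, strategy t -> x <= payoff_against t) ->
  x <= game_value u g.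
Proof.
move=> xP; rewrite game_valueE; apply: lb_le_inf.
  exact: (payoff_against_has_inf g).1.
by move=> _ [t st <-]; exact: xP.
Qed.

Lemma game_value_bounded (g : payoff R K) : `|game_value u g| <= \sum_k p k.
Proof.
have [t0 st0] := strategy_neq0 S2 (act2_neq0 g).
rewrite ler_norml game_value_ge => [|t st]; last first.
  by case/andP: (payoff_against_bounded st).
rewrite (le_trans (game_value_le st0))//.
by case/andP: (payoff_against_bounded st0).
Qed.

End TwoPlayers.
End Induced.

(** * Conditional independence and loss of information *)

Section ConditionalIndependence.
Variables (R : realType) (K : finType).

(** In a state of probability zero the conditional law of player 2's signal is
    not defined; the law in any state of positive probability serves as well,
    because player 1's factor vanishes there. *)
Lemma product_form_of_cond_indep (S1 S2 : countType)
    (u : info_struct R K S1 S2) :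
  conditionally_independent u ->
  exists p al be, product_form u p al be.
Proof.
move=> ci.
have u1 : sums_to u 1 by split; [exact: mass_ge0|exact: mass_sum1].
have uk k : sums_to (fun s => u (k, s.1, s.2)) (prob_state u k).
  apply: (sums_to_inj (e := fun s => (k, s.1, s.2))) u1.
  by move=> [a b] [c d] /= [-> ->].
have [mar1 mar1_sum] := all_and2 (fun k => sums_to_curry (uk k)).
have [mar2 mar2_sum] := all_and2 (fun k => sums_to_curry (sums_to_swap (uk k))).
have [k1 pk1] : exists k, 0 < prob_state u k.
  have [//|no] := pselect (exists k, 0 < prob_state u k).
  have u0 x : u x = 0.
    case: x => [[k s1] s2]; apply/eqP; rewrite eq_le mass_ge0 andbT.
    rewrite (le_trans (sums_to_term_le (s1, s2) (uk k)))// leNgt.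
    by apply/negP => pk; apply: no; exists k.
  have /eqP : 1 = 0 :> R.
    rewrite -(csum_sums_to u1) (_ : mass u = fun=> 0); last exact/funext.
    exact: csum_sums_to (sums_to0 _ _).
  by rewrite oner_eq0.
pose kk k := if 0 < prob_state u k then k else k1.
have pkk k : 0 < prob_state u (kk k) by rewrite /kk; case: ifP.
exists (prob_state u), (fun k s1 => csum (fun s2 => u (k, s1, s2))).
exists (fun k => cond_prob2 u (kk k)); split=> [k|k|k s1 s2].
- exact: mar1_sum.
- have p0 := pkk k.
  have := sums_toZ (ltW (_ : 0 < (prob_state u (kk k))^-1)) (mar2_sum (kk k)).
  rewrite invr_gt0 mulVf ?gt_eqF// => /(_ p0).
  by congr sums_to; apply/funext => s2; rewrite mulrC.
rewrite /kk; case: ifPn => [p0|]; last first.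
  rewrite -leNgt => p0.
  have u0 s2' : u (k, s1, s2') = 0.
    apply/eqP; rewrite eq_le mass_ge0 andbT.
    exact: le_trans (sums_to_term_le (s1, s2') (uk k)) p0.
  rewrite u0 (_ : (fun _ => _) = fun=> 0); last exact/funext.
  by rewrite (csum_sums_to (sums_to0 _ _)) mul0r.
have := ci k p0 s1 s2; rewrite /cond_prob /cond_prob1 mulrAC.
by move/(divIf (lt0r_neq0 p0)).
Qed.

Variables (C C' D : countType) (u : info_struct R K (C * C')%type D).
Variables (p : K -> R) (al : K -> C * C' -> R) (be : K -> D -> R).
Hypothesis uP : product_form u p al be.

(** The factor of player 2 is common to [u] and its marginal.  This is why a
    single problem built from a strategy [t] serves for both structures. *)
Definition marg_kernel (k : K) (c : C) : R := csum (fun c' => al k (c, c')).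

Lemma marg_product_form : product_form (marg_info u) p marg_kernel be.
Proof.
case: uP => alP beP uE; split=> // [k|k c d].
  exact: (sums_to_curry (alP k)).2.
rewrite /marg_kernel /= /marg_mass /= mulrC.
have := sums_toZ ((beP k).1 d) ((sums_to_curry (alP k)).1 c).
move=> /csum_sums_to <-; congr csum; apply/funext => c'.
by rewrite uE mulrC.
Qed.

(** Playing [s] without seeing [c'] is the same as seeing it and ignoring it. *)
Lemma induced_marg (I : finType) (s : C -> I -> R) : strategy s ->
  induced marg_kernel s = induced al (fun z => s z.1).
Proof.
case: uP => alP _ _ ss; apply/funext => -[k i].
have ss' : strategy (fun z : C * C' => s z.1) by move=> z; exact: ss.
have [alc _] := sums_to_curry (alP k).
have [_ /csum_sums_to <-] := sums_to_curry (induced_sums_to alP (k, i) ss').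
congr csum; apply/funext => c /=.
have /andP[s0 _] := strategy_le1 c i ss.
have /csum_sums_to := sums_toZ s0 (alc c).
rewrite mulrC => <-; congr csum; apply/funext => c'.
by rewrite mulrC.
Qed.

Lemma payoff_against_marg_le (g : payoff R K) (t : D -> act2 g -> R) :
  strategy t -> payoff_against (marg_info u) t <= payoff_against u t.
Proof.
move=> st; apply: ge_sup.
  exact: (payoff_against_has_sup marg_product_form st).1.
move=> _ [s ss <-].
have ss' : strategy (fun z : C * C' => s z.1) by move=> z; exact: ss.
rewrite (expected_payoffE marg_product_form ss st) induced_marg//.
by rewrite -(expected_payoffE uP ss' st); exact: (payoff_against_ge uP ss' st).
Qed.

End ConditionalIndependence.

(** * Single-agent problems and the distance *)

Section AgainstFixedReply.
Variables (R : realType) (K : finType).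

(** The action set of player 2 is kept although the payoff ignores it; in this
    way strategies for [g] are also strategies for the new problem. *)
Definition reply_problem (S2 : countType) (be : K -> S2 -> R)
    (g : payoff R K) (t : S2 -> act2 g -> R)
   (b : forall x, -1 <= reply_payoff be t x <= 1) : payoff R K :=
  @Payoff R K _ _ (act1_neq0 g) (act2_neq0 g)
    (fun k i _ => reply_payoff be t (k, i)) (fun k i _ => b (k, i)).

(** Player 2 cannot influence the payoff, so any strategy yields what [t]
    yields in the original game; it only matters that the mixed actions it
    induces have total mass one. *)
Lemma reply_problem_value (S1 S2 : countType) (u : info_struct R K S1 S2)
    p al be (uP : product_form u p al be) (g : payoff R K)
    (t : S2 -> act2 g -> R) b :
  strategy t ->
  game_value u (@reply_problem S2 be g t b) = payoff_against u t.
Proof.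
move=> st.
have E (s : S1 -> act1 g -> R) (t' : S2 -> act2 g -> R) :
    strategy s -> strategy t' ->
    expected_payoff u (g := reply_problem b) s t' = expected_payoff u s t.
  move=> ss st'.
  rewrite (expected_payoffE (g := reply_problem b) uP ss st').
  rewrite (expected_payoffE uP ss st); congr dot; apply/funext => -[k i].
  case: (uP) => _ beP _.
  by rewrite {1}/reply_payoff/= -mulr_suml (induced_sum beP _ st') mul1r.
have against (t' : S2 -> act2 g -> R) : strategy t' ->
    payoff_against u (g := reply_problem b) t' = payoff_against u t.
  move=> st'; congr sup; apply/seteqP; split=> _ [s ss <-]; exists s => //.
    by rewrite E.
  by rewrite E.
apply/eqP; rewrite eq_le; apply/andP; split.
  by rewrite -(against _ st); apply: (game_value_le (g := reply_problem b) uP).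
by apply: (game_value_ge (g := reply_problem b) uP) => t' st'; rewrite against.
Qed.

End AgainstFixedReply.

Theorem corollary7 (R : realType) (K : finType) (hK : (2 <= #|K|)%N)
    (C C' D : countType) (u : info_struct R K (C * C')%type D)
    (hu : conditionally_independent u) :
  value_dist u (marg_info u) = value_dist1 u (marg_info u).
Proof.
have [p [al [be uP]]] := product_form_of_cond_indep hu.
have vP := marg_product_form uP.
pose v := marg_info u.
have bound g : `|game_value u g - game_value v g| <= \sum_k p k + \sum_k p k.
  apply: le_trans (ler_normB _ _) _.
  by rewrite lerD// ?(game_value_bounded uP) ?(game_value_bounded vP).
have zero_bounded : forall (k : K) (i j : unit), -1 <= (0 : R) <= 1.
  by move=> *; rewrite lerN10 ler01.
have unit1 : (0 < #|{: unit}|)%N by rewrite card_unit.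
pose g0 : payoff R K := Payoff unit1 unit1 zero_bounded.
have has_sup1 : has_sup [set r | exists2 g : payoff R K, single_agent g &
    r = `|game_value u g - game_value v g|].
  split; first by eexists; exists g0.
  by exists (\sum_k p k + \sum_k p k) => _ [g _ ->].
have has_sup0 : has_sup [set r | exists g : payoff R K,
    r = `|game_value u g - game_value v g|].
  split; first by eexists; exists g0.
  by exists (\sum_k p k + \sum_k p k) => _ [g ->].
apply/eqP; rewrite eq_le; apply/andP; split; last first.
  apply: ge_sup; first exact: has_sup1.1.
  by move=> _ [g _ ->]; apply: (ub_le_sup has_sup0.2); exists g.
apply: ge_sup; first exact: has_sup0.1.
move=> _ [g ->].
have vu : game_value v g <= game_value u g.
  apply: (game_value_ge uP) => t st.
  exact: le_trans (game_value_le vP st) (payoff_against_marg_le uP st).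
rewrite ger0_norm ?subr_ge0//; apply/ler_addgt0Pr => e e0.
have [_ [t st <-] vt] := inf_adherent e0 (payoff_against_has_inf vP g).
rewrite -[inf _]/(minmax v g) -(game_valueE vP) in vt.
have b x : -1 <= reply_payoff be t x <= 1.
  by rewrite -ler_norml (reply_payoff_bounded uP).
pose h := reply_problem b.
have uh := reply_problem_value uP b st.
have vh := reply_problem_value vP b st.
have ug := game_value_le uP st.
have : `|game_value u h - game_value v h| <= value_dist1 u v.
  by apply: (ub_le_sup has_sup1.2); exists h.
rewrite uh vh => /(le_trans (ler_norm _)); rewrite -(lerD2r e).
apply: le_trans; rewrite -addrA lerD//.
by rewrite lerNl opprD opprK lerBlDr ltW.
Qed.
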